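(* Let $k,n$ be integers with $3\le k\le n$ and let $G$ be a connected graph of order $n$. Then $\tau_k(G)=0$ if and only if $G$ satisfies one of the following: (1) $0\le \kappa(G)\le k-2$; (2) $\kappa(G)=\delta(G)=k-1$; (3) $\kappa(G)=k-1$, $\delta(G)\ge k$, and there exists $S\subseteq V(G)$ with $|S|=k$ such that for every $S'\subseteq S$ with $|S'|=k-1$, letting $u_1$ be the vertex of $S\setminus S'$ and $G_i$ the connected component of $G\setminus S'$ containing $u_1$, for every vertex $x\in V(G_i)\setminus S$ and every $(x,S')$-fan, $u_1$ is an internal vertex of some path belonging to this $(x,S')$-fan.
   Context: $\kappa(G)$ is the vertex connectivity and $\delta(G)$ the minimum degree of $G$. Given a vertex $x$ and a vertex set $U$, an $(x,U)$-fan is a set of paths from $x$ to $U$ any two of which share only the vertex $x$; its size is the number of paths. For $S\subseteq V(G)$ with $|S|\ge 2$, a pedant $S$-Steiner tree is a subgraph of $G$ that is a tree containing $S$ in which every vertex of $S$ has degree exactly one. Two pedant $S$-Steiner trees $T,T'$ are internally disjoint if $E(T)\cap E(T')=\emptyset$ and $V(T)\cap V(T')=S$. $\tau_G(S)$ is the maximum number of pairwise internally disjoint pedant $S$-Steiner trees in $G$, and $\tau_k(G)=\min\{\tau_G(S): S\subseteq V(G),\ |S|=k\}$.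
   Formalization: In (3), ''every (x,S')-fan'' is taken to mean every (x,S')-fan of size k-1; with fans of arbitrary size, including the empty fan, (3) can never hold and the claim fails (k=3, three copies of K_4 in a ring sharing cut vertices a, b, c). *)

(* Defs.v *)
From mathcomp Require Import all_boot.

Set Implicit Arguments.
Unset Strict Implicit.
Unset Printing Implicit Defensive.

(* A simple graph is a symmetric irreflexive relation e on a finType T. *)

(* Junk value 0 when no i satisfies P. *)
Definition minval (I : finType) (P : pred I) (F : I -> nat) : nat :=
  if [pick i | P i] is Some i0 then F [arg min_(i < i0 | P i) F i] else 0.

Section Graphs.
Variables (T : finType) (e : rel T).

Definition induced (A : {set T}) : rel T :=
  [rel x y | [&& x \in A, y \in A & e x y]].

Definition connected_in (A : {set T}) : bool :=
  [forall x in A, forall y in A, connect (induced A) x y].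

Definition component (A : {set T}) (u : T) : {set T} :=
  [set x in A | connect (induced A) u x].

Definition deg (x : T) : nat := #|[set y | e x y]|.

Definition min_degree : nat := minval predT deg.

(* Deleting U must disconnect the graph or leave at most one vertex, so that
   the complete graph on n > 0 vertices has connectivity n - 1. *)
Definition separating (U : {set T}) : bool :=
  ~~ connected_in (~: U) || (#|~: U| <= 1).

Definition kappa : nat := minval separating (fun U : {set T} => #|U|).

(* Bounding the length by #|T| loses nothing: the cycles are duplicate-free. *)
Definition acyclic : bool :=
  [forall m : 'I_#|T|.+1, forall c : m.-tuple T,
     (2 < m) ==> ~~ ucycleb e c].

Definition edges : {set {set T}} :=
  [set E : {set T} | [exists x, exists y, e x y && (E == [set x; y])]].

(* The path is x :: p. *)
Definition is_path_to (x : T) (U : {set T}) (p : seq T) : bool :=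
  [&& path e x p, uniq (x :: p) & last x p \in U].

(* Q lists the paths without their common origin x. *)
Definition is_fan (x : T) (U : {set T}) (Q : seq (seq T)) : Prop :=
  [/\ uniq Q,
      forall p, p \in Q -> is_path_to x U p
    & forall p q, p \in Q -> q \in Q -> p != q ->
      forall z, z \in x :: p -> z \in x :: q -> z = x].

End Graphs.

Definition internal_vertex (T : eqType) (x : T) (p : seq T) (u : T) : bool :=
  [&& u \in x :: p, u != x & u != last x p].

(* Vertex set and edge set, edges being two-element vertex sets. *)
Notation subgraph T := ({set T} * {set {set T}})%type.

Section Steiner.
Variables (T : finType) (e : rel T).
Implicit Types (H : subgraph T) (S : {set T}).

Definition verts H : {set T} := H.1.
Definition sedges H : {set {set T}} := H.2.
Definition adj H : rel T := [rel x y | [set x; y] \in sedges H].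

Definition is_subgraph H : bool :=
  (sedges H \subset edges e) && [forall a in sedges H, a \subset verts H].

Definition is_tree H : bool :=
  [&& verts H != set0, connected_in (adj H) (verts H) & acyclic (adj H)].

Definition pedant_tree S H : bool :=
  [&& is_subgraph H, is_tree H, S \subset verts H
    & [forall x in S, deg (adj H) x == 1]].

Definition internally_disjoint S H H' : bool :=
  (sedges H :&: sedges H' == set0) && (verts H :&: verts H' == S).

Definition pedant_family S (F : {set subgraph T}) : bool :=
  [forall H in F, pedant_tree S H] &&
  [forall H in F, forall H' in F, (H != H') ==> internally_disjoint S H H'].

Definition tau S : nat :=
  \max_(F : {set subgraph T} | pedant_family S F) #|F|.

Definition tau_k (k : nat) : nat :=
  minval (fun S : {set T} => #|S| == k) tau.

End Steiner.

(* Fans are taken of the full size k - 1 = #|S'|; for smaller ones the last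
   clause would fail trivially, e.g. for the empty fan. *)
Definition fan_condition (T : finType) (e : rel T) (k : nat) : Prop :=
  exists S : {set T}, #|S| = k /\
    forall (S' : {set T}) (u1 : T),
      S' \subset S -> #|S'| = k - 1 -> S :\: S' = [set u1] ->
      forall x : T, x \in component e (~: S') u1 -> x \notin S ->
      forall Q : seq (seq T), is_fan e x S' Q -> size Q = k - 1 ->
      exists2 p, p \in Q & internal_vertex x p u1.

(* Main.v *)
Require Import Defs.
From mathcomp Require Import all_boot.

(** A set S with at least three vertices has a pedant Steiner tree iff some
    connected set C disjoint from S is adjacent to every vertex of S: take the
    tree minus its leaves S, resp. a spanning tree of C plus one edge for each
    vertex of S. So tau_k = 0 iff some k-set S has no such C. If kappa >= k,
    every component of G - S works; if kappa <= k - 2, a minimum cut together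
    with two vertices that it separates extends to a bad S; a vertex of degree
    k - 1 and its neighbours form a bad S. When kappa = k - 1, a fan avoiding u1
    would lie in one component of G - S, which is then adjacent to all of S;
    conversely, if C exists then Menger's theorem and the submodularity of the
    neighbourhood function give a fan from a vertex of C avoiding some u1. *)

Set Implicit Arguments.
Unset Strict Implicit.
Unset Printing Implicit Defensive.

(** * Walks and Menger's theorem *)

Section Walks.
Variable T : finType.
Implicit Types (e : rel T) (A B X Y Z : {set T}).

Lemma path_induced e A x p :
  x \in A -> path (induced e A) x p = path e x p && all (mem A) p.
Proof.
elim: p x => //= y p IH x xA; rewrite {1}/induced /= xA /=.
by case: (boolP (y \in A)) => yA; rewrite ?andbF //= IH // andbA.
Qed.

Lemma path_induced_sub e A x p : path (induced e A) x p -> path e x p.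
Proof. by apply: sub_path => ? ? /and3P[]. Qed.

(** An edge may be stretched to a walk or collapsed to a point, as when the leaves of a tree are
    retracted onto their neighbours. *)
Lemma connect_morph (e e' : rel T) (f : T -> T) x y :
  (forall a b, e a b -> connect e' (f a) (f b)) ->
  connect e x y -> connect e' (f x) (f y).
Proof.
move=> fe /connectP[p]; elim: p x => [x _ -> //|z p IH x /= /andP[xz zp] yE].
exact: connect_trans (fe _ _ xz) (IH _ zp yE).
Qed.

Lemma connect_inv e (P : pred T) x y :
  (forall a b, P a -> e a b -> P b) -> connect e x y -> P x -> P y.
Proof.
move=> inv /connectP[p xp ->]; elim: p x xp => //= z p IH x /andP[xz zp] Px.
exact/(IH _ zp)/(inv x).
Qed.

Lemma induced_sym e A : symmetric e -> symmetric (induced e A).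
Proof. by move=> sym x y; rewrite /induced /= sym andbCA. Qed.

Lemma connect_induced_mono e A B :
  A \subset B -> subrel (connect (induced e A)) (connect (induced e B)).
Proof.
move=> /subsetP AB; apply: connect_sub => x y /and3P[/AB xB /AB yB xy].
by apply: connect1; rewrite /induced /= xB yB.
Qed.

Lemma connect_induced_in e A x y :
  connect (induced e A) x y -> x \in A -> y \in A.
Proof.
move=> /connectP[p xp ->] xA; move: xp; rewrite path_induced // => /andP[_].
by case: p => //= z p; move=> /andP[zA /allP pA]; have := mem_last z p;
  rewrite inE => /orP[/eqP->|/pA].
Qed.

Lemma first_hit e X a p : path e a p -> has (mem X) (a :: p) ->
  exists p', [/\ path e a p', last a p' \in X, all (predC (mem X)) (belast a p')
                & {subset a :: p' <= a :: p}].
Proof.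
elim: p a => [|b p IH] a /=.
  rewrite orbF => _ aX; exists [::]; by split.
move=> /andP[ab bp] hX; case: (boolP (a \in X)) => aX.
  by exists [::]; split=> // z; rewrite !inE => ->.
move: hX; rewrite (negPf aX) /= => /(IH _ bp)[p' [bp' lX nX sub]].
exists (b :: p'); split=> //=; rewrite ?ab ?inE ?aX //.
by move=> z; rewrite inE => /orP[/eqP->|/sub zp]; rewrite inE ?eqxx ?zp ?orbT.
Qed.

Lemma last_hit e X a p : path e a p -> has (mem X) (a :: p) ->
  exists v p', [/\ v \in X, path e v p', last v p' = last a p,
                 all (predC (mem X)) p' & {subset v :: p' <= a :: p}].
Proof.
elim: p a => [|b p IH] a /=.
  by rewrite orbF => _ aX; exists a, [::]; split.
move=> /andP[ab bp] hX.
case: (boolP (has (mem X) (b :: p))) => hbp.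
  have [v [p' [vX vp lE nX sub]]] := IH _ bp hbp.
  by exists v, p'; split=> // z /sub zp; rewrite inE zp orbT.
have aX : a \in X by move: hX hbp; case: (a \in X) => //= ->.
by exists a, (b :: p); split=> //=; [rewrite ab|move: hbp; rewrite -all_predC].
Qed.

Definition separates e A B X : bool :=
  [forall a in A :\: X, forall b in B :\: X, ~~ connect (induced e (~: X)) a b].

Lemma separatesP e A B X :
  reflect (forall a p, a \in A -> path e a p -> last a p \in B ->
             has (mem X) (a :: p))
          (separates e A B X).
Proof.
apply: (iffP forall_inP) => [sepX a p aA ap pB|hit a].
  apply: contraT; rewrite -all_predC => /allP nX.
  have nXC z : z \in a :: p -> z \in ~: X by move=> /nX; rewrite !inE.
  have aD : a \in A :\: X.
    by rewrite inE aA andbT -in_setC nXC // mem_head.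
  have lD : last a p \in B :\: X by rewrite inE pB andbT -in_setC nXC // mem_last.
  have /forall_inP/(_ _ lD)/negP[] := sepX _ aD.
  apply/connectP; exists p => //; rewrite path_induced ?nXC ?mem_head // ap.
  by apply/allP=> z zp; apply: nXC; rewrite inE zp orbT.
rewrite inE => /andP[aX aA]; apply/forall_inP=> b; rewrite inE => /andP[bX bB].
apply/negP=> /connectP[p ap bE].
have aXC : a \in ~: X by rewrite inE.
have := hit _ _ aA (path_induced_sub ap); rewrite -bE => /(_ bB) /=.
move: ap; rewrite path_induced // => /andP[_ /allP pX].
rewrite (negPf aX) => /hasP[z /pX]; rewrite !inE => /negPf zX.
by rewrite /= zX.
Qed.

(** Disjoint paths are indexed by their last vertices, so that their number is [#|Z|]; [h z] is the
    first vertex of the path ending at [z], and [t z] the rest of it. *)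
Definition linkage e A Z (h : T -> T) (t : T -> seq T) : Prop :=
  (forall z, z \in Z -> [/\ h z \in A, path e (h z) (t z), last (h z) (t z) = z
                        & uniq (h z :: t z)]) /\
  (forall z z' v, z \in Z -> z' \in Z ->
     v \in h z :: t z -> v \in h z' :: t z' -> z = z').

Lemma linkage_uniq e A (Z : {set T}) h t :
  (forall z, z \in Z -> [/\ h z \in A, path e (h z) (t z)
                        & last (h z) (t z) = z]) ->
  (forall z z' v, z \in Z -> z' \in Z ->
     v \in h z :: t z -> v \in h z' :: t z' -> z = z') ->
  exists t', linkage e A Z h t'.
Proof.
move=> ht dis; exists (fun z => shorten (h z) (t z)).
have short z : z \in Z ->
  [/\ path e (h z) (shorten (h z) (t z)), last (h z) (shorten (h z) (t z)) = z,
      uniq (h z :: shorten (h z) (t z))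
    & {subset h z :: shorten (h z) (t z) <= h z :: t z}].
  move=> /ht[hA hp]; case: (shortenP hp) => p' hp' up' sub lE; split=> //.
  by move=> v; rewrite !inE => /orP[->//|/sub->]; rewrite orbT.
split=> [z zZ|z z' v zZ z'Z].
  by have [? ? ? _] := short z zZ; have [? _ _] := ht z zZ; split.
have [_ _ _ sub] := short z zZ; have [_ _ _ sub'] := short z' z'Z.
by move=> /sub vz /sub'; apply: dis zZ z'Z vz.
Qed.

Lemma linkage_subrel e e' A Z h t :
  subrel e e' -> linkage e A Z h t -> linkage e' A Z h t.
Proof.
move=> ee' [ht dis]; split=> // z /ht[hA hp lE u]; split=> //.
exact: sub_path hp.
Qed.

(** Only one orientation goes: Menger's theorem is proved for digraphs, by induction on the number
    of arcs. *)
Definition del_arc e (x y : T) : rel T :=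
  [rel a b | e a b && ~~ ((a == x) && (b == y))].

Lemma path_del_arc_tail e x y X a p : x \in X -> path e a p ->
  all (predC (mem X)) (belast a p) -> path (del_arc e x y) a p.
Proof.
move=> xX; elim: p a => //= b p IH a /andP[ab bp] /andP[aX nX].
rewrite {1}/del_arc /= ab (IH _ bp nX) andbT /=; apply: contra aX => /andP[/eqP-> _].
exact: xX.
Qed.

Lemma path_del_arc_head e x y X a p : y \in X -> path e a p ->
  all (predC (mem X)) p -> path (del_arc e x y) a p.
Proof.
move=> yX; elim: p a => //= b p IH a /andP[ab bp] /andP[bX nX].
rewrite {1}/del_arc /= ab (IH _ bp nX) andbT /=; apply: contra bX => /andP[_ /eqP->].
exact: yX.
Qed.

Lemma path_del_arc e x y a p : path e a p ->
  path (del_arc e x y) a p \/ x \in a :: p /\ y \in a :: p.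
Proof.
elim: p a => [|b p IH] a /=; first by left.
move=> /andP[ab /IH[bp|[xp yp]]]; last by right; rewrite !(in_cons a) xp yp !orbT.
rewrite {1}/del_arc /= ab bp andbT; case: (boolP ((a == x) && (b == y))) => [|_]; last by left.
by move=> /andP[/eqP<- /eqP<-]; right; rewrite !inE !eqxx orbT.
Qed.

(* The induction step of Goering's proof: a separator X of G - xy with fewer
   than l vertices yields the l-separators x + X and y + X of G; linkages from A
   to the former and from the latter to B can meet only in X. *)
Lemma menger_merge e A B X Z x y hp tp hq tq :
  e x y -> x \notin X -> y \notin X ->
  #|x |: X| <= #|Z| ->
  separates (del_arc e x y) A B X ->
  linkage (del_arc e x y) A (x |: X) hp tp ->
  Z \subset B -> linkage (del_arc e x y) (y |: X) Z hq tq ->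
  exists h t, linkage e A Z h t.
Proof.
move=> xy xX yX leZ /separatesP sepX [Ph Pdis] /subsetP ZB [Qh Qdis].
have sube : subrel (del_arc e x y) e by move=> a b /andP[].
have hq_inj : {in Z &, injective hq}.
  move=> z z' zZ z'Z E; apply: (Qdis _ _ (hq z)) => //.
    exact: mem_head.
  by rewrite E mem_head.
(* The starting points are distinct, and there are at least as many paths as vertices in
   [y |: X]. *)
have hq_onto : hq @: Z = y |: X.
  apply/eqP; rewrite eqEcard card_in_imset //; apply/andP; split.
    by apply/subsetP=> _ /imsetP[z /Qh[? _ _ _] ->].
  by apply: leq_trans leZ; rewrite !cardsU1 xX yX.
have headQ z v : z \in Z -> v \in y |: X -> v \in hq z :: tq z -> v = hq z.
  rewrite -hq_onto => zZ /imsetP[z' z'Z ->] vz.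
  by rewrite (Qdis z z' (hq z')) // mem_head.
have lastP s v : s \in x |: X -> v \in x |: X -> v \in hp s :: tp s -> v = s.
  move=> sP vP vs; apply: (Pdis v s v) => //.
  by have [_ _ vE _] := Ph v vP; rewrite -{1}vE mem_last.
(* Suppose two paths cross at [v]. The first part of one followed by the last part of the other
   leads from [A] to [B] without the arc, so it hits [X] at some [w]. On the first part [w] is the
   end [s], which forces [v = s]; on the last part [w] would repeat the start [hq z]. *)
have cross s z v : s \in x |: X -> z \in Z -> v \in hp s :: tp s ->
    v \in hq z :: tq z -> [/\ v \in X, v = s & v = hq z].
  move=> sP zZ vs vz.
  suff vX : v \in X.
    by split=> //; [apply: lastP|apply: headQ]; rewrite // inE vX orbT.
  have [hA hpath lE up] := Ph s sP; have [_ qpath qE uq] := Qh z zZ.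
  have [p1 [p2 [tpE p1v]]] : exists p1 p2, tp s = p1 ++ p2 /\ last (hp s) p1 = v.
    by case/splitPl: vs => p1 p2 ?; exists p1, p2.
  have [q1 [q2 [tqE q1v]]] : exists q1 q2, tq z = q1 ++ q2 /\ last (hq z) q1 = v.
    by case/splitPl: vz => q1 q2 ?; exists q1, q2.
  move: hpath lE up; rewrite tpE cat_path last_cat p1v => /andP[ap1 vp2] lE up.
  move: qpath qE uq; rewrite tqE cat_path last_cat q1v => /andP[bq1 vq2] qE uq.
  have /(_ _) := sepX (hp s) (p1 ++ q2) hA.
  rewrite cat_path last_cat p1v ap1 vq2 qE => /(_ isT (ZB _ zZ)).
  rewrite -cat_cons has_cat => /orP[|] /hasP[w win wX].
    have ws : w = s.
      by apply: lastP => //; [rewrite inE [w \in X]wX orbT|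
                             rewrite tpE -cat_cons mem_cat [w \in _]win].
    move: up win; rewrite -cat_cons cat_uniq => /and3P[_ /hasPn np2 _].
    case: p2 {ap1 vp2 tpE} lE np2 => [|c p2] /= lE np2 win.
      by rewrite lE -ws.
    have /np2 : s \in c :: p2 by rewrite -lE mem_last.
    by rewrite -{1}ws => /negP[].
  have wz : w = hq z.
    by apply: headQ => //; [rewrite inE [w \in X]wX orbT|
                           rewrite tqE -cat_cons mem_cat [w \in q2]win orbT].
  by move: uq; rewrite -cat_cons cat_uniq => /and3P[_ /hasPn/(_ _ win)];
    rewrite wz /= mem_head.
(* A path starting in [X] is glued to the one ending at the same vertex; the path starting at [y] is
   glued, through the arc, to the one ending at [x]. *)
pose sg z := if hq z \in X then hq z else x.
have sgP z : sg z \in x |: X.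
  by rewrite /sg !inE; case: ifP => [->|]; rewrite ?orbT ?eqxx.
have sg_inj z z' : z \in Z -> z' \in Z -> sg z = sg z' -> z = z'.
  move=> zZ z'Z E; apply: hq_inj => //; move: E.
  have : hq z \in y |: X by rewrite -hq_onto imset_f.
  have : hq z' \in y |: X by rewrite -hq_onto imset_f.
  rewrite /sg !inE; case: ifP => [zX|_]; case: ifP => [z'X|_] //=.
  - by move=> _ _ E; move: xX; rewrite -E zX.
  - by move=> _ _ E; move: xX; rewrite E z'X.
  by rewrite !orbF => /eqP-> /eqP->.
pose tl z := if hq z \in X then tq z else y :: tq z.
have tlP z : z \in Z -> path e (sg z) (tl z) /\ last (sg z) (tl z) = z.
  move=> zZ; have [_ qpath qE _] := Qh z zZ.
  have {qpath} qpath := sub_path sube qpath.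
  have : hq z \in y |: X by rewrite -hq_onto imset_f.
  rewrite /sg /tl !inE; case: ifP => [//|_]; rewrite orbF => /eqP hE.
  by rewrite /= xy -hE.
have tl_sub z v : z \in Z -> v \in tl z -> v \in hq z :: tq z.
  move=> zZ; have : hq z \in y |: X by rewrite -hq_onto imset_f.
  rewrite /tl !inE; case: ifP => [_ _ ->|_]; first by rewrite orbT.
  by rewrite orbF => /eqP->; rewrite inE.
have [] := @linkage_uniq e A Z (hp \o sg) (fun z => tp (sg z) ++ tl z).
- move=> z zZ; have [? ppath pE _] := Ph _ (sgP z).
  have [qpath qE] := tlP _ zZ.
  by rewrite /= cat_path last_cat pE (sub_path sube ppath).
- move=> z z' v zZ z'Z; rewrite /= -!cat_cons !mem_cat.
  have sgX u : hq u \in X -> sg u = hq u by rewrite /sg => ->.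
  move=> /orP[vz|/(tl_sub _ _ zZ) vz] /orP[vz'|/(tl_sub _ _ z'Z) vz'].
  + exact/sg_inj/(Pdis _ _ v).
  + have [vX vs vh] := cross _ _ _ (sgP z) z'Z vz vz'.
    by apply: sg_inj; rewrite // -vs sgX // -vh.
  + have [vX vs vh] := cross _ _ _ (sgP z') zZ vz' vz.
    by apply: sg_inj; rewrite // -vs sgX // -vh.
  exact: Qdis vz vz'.
by move=> t ?; exists (hp \o sg), t.
Qed.

Definition arcs e : {set T * T} := [set a | e a.1 a.2].

(** A path through the deleted arc contains both of its ends; any other path already meets [X]. *)
Lemma separates_endpoint e A B X Y x y v :
  separates (del_arc e x y) A B X -> X \subset Y -> v \in Y ->
  v \in [set x; y] -> separates e A B Y.
Proof.
move=> /separatesP sepX /subsetP XY vY vxy; apply/separatesP=> a p aA ap pB.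
case: (path_del_arc x y ap) => [ap'|[xp yp]].
  have /hasP[z zp zX] := sepX _ _ aA ap' pB.
  by apply/hasP; exists z => //; apply: XY.
apply/hasP; exists v => //.
by move: vxy; rewrite in_set2 => /orP[]/eqP->.
Qed.

Theorem menger e A B l :
  (forall X, separates e A B X -> l <= #|X|) ->
  exists Z h t, [/\ Z \subset B, l <= #|Z| & linkage e A Z h t].
Proof.
move: {-1}#|_| (leqnn #|arcs e|) => m; elim: m e A B => [|m IH] e A B.
  rewrite leqn0 cards_eq0 => /eqP e0 sep.
  (* Without arcs all paths are single vertices, so [A :&: B] separates. *)
  exists (A :&: B), id, (fun=> [::]); split; first exact: subsetIr.
    apply: sep; apply/separatesP=> a [|b p] aA /= => [_ aB|/andP[ab]].
      by rewrite !inE aA aB.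
    by have := in_set0 (a, b); rewrite -e0 inE ab.
  split=> [z|z z' v _ _]; first by rewrite inE => /andP[].
  by rewrite !inE => /eqP-> /eqP.
move=> em sep; case: (set_0Vmem (arcs e)) => [e0|[[x y]]].
  by apply: IH sep; rewrite e0 cards0.
rewrite inE /= => xy; pose e' := del_arc e x y.
have sube : subrel e' e by move=> a b /andP[].
have e'm : #|arcs e'| <= m.
  rewrite -ltnS; apply: leq_trans em; apply: proper_card.
  apply/properP; split; first by apply/subsetP=> -[a b]; rewrite !inE => /sube.
  by exists (x, y); rewrite inE //= /e' /del_arc /= !eqxx andbF.
case: (pickP (fun X => separates e' A B X && (#|X| < l))) => [X|none]; last first.
  have [X sepX|Z [h [t [ZB lZ L]]]] := IH e' A B e'm.
    by rewrite leqNgt; apply/negP=> lX; have := none X; rewrite sepX lX.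
  by exists Z, h, t; split=> //; apply: linkage_subrel L.
move=> /andP[sepX ltX].
have sepU v : v \in [set x; y] -> separates e A B (v |: X).
  by move=> vxy; apply: separates_endpoint sepX (subsetUr _ _) (setU11 _ _) vxy.
(* Enlarged by an end of the arc, [X] separates in the full graph and so has at least [l] elements,
   while [X] alone has fewer. *)
have out v : v \in [set x; y] -> v \notin X /\ #|v |: X| = l.
  move=> vxy; have := sep _ (sepU _ vxy); rewrite cardsU1.
  case: (v \in X) => /=; first by rewrite add0n leqNgt ltX.
  by move=> lX; split=> //; apply/eqP; rewrite eqn_leq lX add1n ltX.
have [xX xl] := out x (set21 _ _); have [yX yl] := out y (set22 _ _).
(* A path from [A] to [B] is cut at its first vertex in [x |: X]; that part cannot use the arc out
   of [x], so [Y] meets it. Below, the part after the last vertex in [y |: X] serves in the same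
   way. *)
have [Y sepY|Z [hp [tp [ZP lZ LP]]]] := IH e' A (x |: X) e'm.
  apply: sep; apply/separatesP=> a p aA ap pB.
  have /(_ _ _ aA ap pB) hit := elimT (separatesP _ _ _ _) (sepU x (set21 _ _)).
  have [p' [ap' lp' np' sub]] := first_hit ap hit.
  have := elimT (separatesP _ _ _ _) sepY a p' aA.
  move=> /(_ (path_del_arc_tail _ (setU11 _ _) ap' np') lp') /hasP[z /sub zp zY].
  by apply/hasP; exists z.
have ZE : Z = x |: X by apply/eqP; rewrite eqEcard ZP xl lZ.
have [Y sepY|Z' [hq [tq [ZB lZ' LQ]]]] := IH e' (y |: X) B e'm.
  apply: sep; apply/separatesP=> a p aA ap pB.
  have /(_ _ _ aA ap pB) hit := elimT (separatesP _ _ _ _) (sepU y (set22 _ _)).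
  have [v [p' [vX vp' lE np' sub]]] := last_hit ap hit.
  have := elimT (separatesP _ _ _ _) sepY v p' vX.
  rewrite lE => /(_ (path_del_arc_head _ (setU11 _ _) vp' np') pB).
  by move=> /hasP[z /sub zp zY]; apply/hasP; exists z.
rewrite ZE in LP.
have [|h [t L]] := menger_merge xy xX yX _ sepX LP ZB LQ; first by rewrite xl.
by exists Z', h, t.
Qed.

End Walks.

(** * Connectivity and fans *)

Lemma minvalP (I : finType) (P : pred I) (F : I -> nat) i0 : P i0 ->
  exists i, [/\ P i, minval P F = F i & forall j, P j -> minval P F <= F j].
Proof.
rewrite /minval => Pi0; case: pickP => [i1 Pi1|/(_ i0)]; last by rewrite Pi0.
by case: arg_minnP => // i Pi min; exists i.
Qed.

Lemma superset_of_card (T : finType) (A : {set T}) k :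
  #|A| <= k <= #|T| -> exists B : {set T}, A \subset B /\ #|B| = k.
Proof.
move=> /andP[Ak kT]; elim: k Ak kT => [|k IH] Ak kT.
  by exists A; split=> //; apply/eqP; rewrite -leqn0.
move: Ak; rewrite leq_eqVlt => /orP[/eqP|]; first by exists A.
rewrite ltnS => /IH /(_ (ltnW kT))[B [AB Bk]].
have /set0Pn[v] : ~: B != set0 by rewrite -card_gt0 -(ltn_add2l #|B|) cardsC addn0 Bk.
rewrite inE => vB; exists (v |: B); rewrite cardsU1 vB Bk; split=> //.
exact: subset_trans AB (subsetUr _ _).
Qed.

Section Connectivity.
Variables (T : finType) (e : rel T).
Hypothesis (e_sym : symmetric e) (e_irr : irreflexive e).
Implicit Types (A B C D S U : {set T}).

Definition nbh A : {set T} := [set y | (y \notin A) && [exists x in A, e x y]].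

Lemma nbhP A y :
  reflect (y \notin A /\ exists2 x, x \in A & e x y) (y \in nbh A).
Proof.
rewrite inE; apply: (iffP andP) => -[yA h]; split=> //.
  by case/exists_inP: h => x; exists x.
by case: h => x xA xy; apply/exists_inP; exists x.
Qed.

(** The union of the two neighbourhoods on the left lies in the union of those on the right, and
    likewise for the intersections. *)
Lemma nbh_submod A B :
  #|nbh (A :&: B)| + #|nbh (A :|: B)| <= #|nbh A| + #|nbh B|.
Proof.
rewrite -cardsUI -[leqRHS]cardsUI leq_add // subset_leq_card //.
  apply/subsetP=> y /setUP[] /nbhP[].
    rewrite inE negb_and => yAB [x /setIP[xA xB] xy]; apply/setUP.
    by case/orP: yAB => yN; [left|right]; apply/nbhP; split=> //; exists x.
  rewrite inE negb_or => /andP[yA yB] [x /setUP[] xN xy]; apply/setUP.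
    by left; apply/nbhP; split=> //; exists x.
  by right; apply/nbhP; split=> //; exists x.
apply/subsetP=> y /setIP[] /nbhP[_ [x /setIP[xA xB] xy]] /nbhP[].
rewrite inE negb_or => /andP[yA yB] _; apply/setIP.
by split; apply/nbhP; split=> //; exists x.
Qed.

Lemma kappa_le U : separating e U -> kappa e <= #|U|.
Proof.
by move=> sU; have [_ [_ _]] := minvalP (fun X : {set T} => #|X|) sU; apply.
Qed.

Lemma kappa_witness : exists2 U, separating e U & kappa e = #|U|.
Proof.
have sT : separating e setT by rewrite /separating setCT cards0 orbT.
by have [U [sU kU _]] := minvalP (fun X : {set T} => #|X|) sT; exists U.
Qed.

Lemma component_refl A x : x \in A -> x \in component e A x.
Proof. by move=> xA; rewrite inE xA connect0. Qed.

Lemma component_sub A x : component e A x \subset A.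
Proof. by apply/subsetP=> y; rewrite inE => /andP[]. Qed.

Lemma nbh_component A x : x \in A -> nbh (component e A x) \subset ~: A.
Proof.
move=> xA; apply/subsetP=> y /nbhP[yC [z]]; rewrite !inE => /andP[zA xz] zy.
apply: contra yC => yA; rewrite inE yA; apply: connect_trans xz (connect1 _).
by rewrite /induced /= zA yA.
Qed.

Lemma component_connected A x : connected_in e (component e A x).
Proof.
set C := component e A x.
suff toC z y : z \in C -> connect (induced e A) z y -> connect (induced e C) z y.
  apply/forall_inP=> y yC; apply/forall_inP=> z zC; apply: toC => //.
  move: yC zC; rewrite !inE (sym_connect_sym (induced_sym A e_sym)).
  by move=> /andP[_ yx] /andP[_]; apply: connect_trans.
move=> zC /connectP[p zp ->] {y}; elim: p z zC zp => //= y p IH z zC.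
move=> /andP[zy yp]; have yC : y \in C.
  move: zC zy; rewrite !inE => /andP[_ xz] /and3P[zA yA zy]; rewrite yA.
  by apply: connect_trans xz (connect1 _); rewrite /induced /= zA yA.
apply: connect_trans (IH _ yC yp); apply: connect1; rewrite /induced /= zC yC.
by case/and3P: zy.
Qed.

(** A walk from [a] that avoids [nbh A] never leaves [A]. *)
Lemma kappa_le_nbh A a b : a \in A -> b \notin A -> b \notin nbh A ->
  kappa e <= #|nbh A|.
Proof.
move=> aA bA bN; apply: kappa_le; apply/orP; left; apply/negP.
have aN : a \in ~: nbh A by rewrite !inE aA.
have bN' : b \in ~: nbh A by rewrite in_setC.
move=> /forall_inP/(_ _ aN)/forall_inP/(_ _ bN').
move=> /connectP[p ap bE]; case/negP: bA; rewrite {}bE {bN bN'}.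
elim: p a aA {aN} ap => //= c p IH a aA /andP[/and3P[_ cN ac]]; apply: IH.
move: cN; rewrite inE; apply: contraR => cA.
by apply/nbhP; split=> //; exists a.
Qed.

Lemma kappa_le_deg x : kappa e <= deg e x.
Proof.
have NE : nbh [set x] = [set y | e x y].
  apply/setP=> y; rewrite !inE; apply/andP/idP=> [[_ /exists_inP[z]]|xy].
    by rewrite inE => /eqP->.
  split; first by apply: contraTneq xy => ->; rewrite e_irr.
  by apply/exists_inP; exists x; rewrite ?set11.
rewrite /deg -NE.
(* If no such [b] exists, deleting the neighbours of [x] leaves at most one vertex. *)
case: (pickP [pred b | (b \notin [set x]) && (b \notin nbh [set x])]) => [b|none].
  by case/andP=> bx bN; apply: kappa_le_nbh (set11 x) bx bN.
apply: kappa_le; apply/orP; right; rewrite -(cards1 x) subset_leq_card //.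
apply/subsetP=> b; rewrite in_setC => bN; move: (none b); rewrite /= bN andbT.
by move/negbFE.
Qed.

Lemma kappa_lt_card : 0 < #|T| -> kappa e < #|T|.
Proof.
move=> T0; have /card_gt0P[x _] := T0.
apply: leq_ltn_trans (kappa_le (U := [set~ x]) _) _.
  by rewrite /separating setCK cards1 orbT.
by rewrite cardsC1 prednK.
Qed.

(** * Linkers and blocked fans *)

Definition linker S C : bool :=
  [&& [disjoint C & S], connected_in e C
    & [forall s in S, exists c in C, e s c]].

(** The demand that [fan_condition] makes of one fixed [S]. *)
Definition fans_blocked S k : Prop :=
  forall (S' : {set T}) (u1 : T),
    S' \subset S -> #|S'| = k - 1 -> S :\: S' = [set u1] ->
    forall x : T, x \in component e (~: S') u1 -> x \notin S ->
    forall Q : seq (seq T), is_fan e x S' Q -> size Q = k - 1 ->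
    exists2 p, p \in Q & internal_vertex x p u1.

(** Menger's theorem is applied, with [x] and [u] removed, between the neighbours of [x] and
    [S :\ u]. Disjoint paths extended back to [x] form the fan; a small separator confines the
    component of [x]. *)
Lemma fan_or_cut S x u : x \notin S -> u \in S ->
  (exists A, [/\ x \in A, [disjoint A & S] & #|nbh A :\ u| < #|S :\ u|]) \/
  exists Q, [/\ is_fan e x (S :\ u) Q, size Q = #|S :\ u|
              & forall p, p \in Q -> u \notin x :: p].
Proof.
move=> xS uS; have xu : x != u by apply: contraNneq xS => ->.
set D := ~: [set x; u]; pose e' := induced e D.
pose N := [set a in D | e x a].
have DP z : (z \in D) = (z != x) && (z != u) by rewrite !inE negb_or.
case: (pickP (fun W => separates e' N (S :\ u) W && (#|W| < #|S :\ u|))).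
  move=> W /andP[/separatesP sepW ltW]; left.
  (* The arbitrary set [W] might contain [x], which must survive; [u] may be added because it is not
     counted among the neighbours of [A]. *)
  set K := u |: (W :\ x); have xK : x \in ~: K by rewrite !inE eqxx orbF.
  exists (component e (~: K) x); split; first exact: component_refl.
    rewrite disjoint_subset; apply/subsetP=> s; rewrite !inE.
    move=> /andP[sK /connectP[p xp sE]]; apply/negP=> sS.
    (* Once free of repetitions, the path never returns to [x], so its tail runs in [e'] from [N] to
       [S :\ u] and must meet [W]. *)
    move: sE; case: (shortenP xp) => q xq uq _ sE.
    move: xq; rewrite path_induced // => /andP[xq /allP qK].
    case: q xq uq qK sE => [|a q] /=; first by move=> _ _ _ sx; rewrite -sx sS in xS.
    move=> /andP[xa aq] /andP[xNq _] qK sE.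
    have qD z : z \in a :: q -> z \in D.
      move=> zq; rewrite DP; apply/andP; split; first by apply: contraNneq xNq => <-.
      by have := qK z zq; rewrite !inE negb_or => /andP[].
    have aD := qD a (mem_head _ _).
    have aN : a \in N by rewrite inE aD.
    have aq' : path e' a q.
      by rewrite path_induced // aq; apply/allP=> z zq; rewrite /= qD // inE zq orbT.
    have := sepW a q aN aq'; rewrite -sE in_setD1 sS andbT.
    move: sK; rewrite negb_or => /andP[-> _] /(_ isT) /hasP[z zq zW].
    have := qK z zq; have := qD z zq; rewrite DP !inE => /andP[-> _].
    by rewrite [z \in W]zW orbT.
  apply: leq_ltn_trans ltW; rewrite subset_leq_card //.
  apply/subsetP=> y; rewrite in_setD1 => /andP[yu /(subsetP (nbh_component xK))].
  by rewrite setCK !inE (negPf yu) => /andP[].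
move=> none; right.
have [W sepW|Z [h [t [ZS lZ [ht dis]]]]] := @menger T e' N (S :\ u) #|S :\ u|.
  by rewrite leqNgt; apply/negP=> lW; have := none W; rewrite sepW lW.
have {ZS lZ} ZE : Z = S :\ u by apply/eqP; rewrite eqEcard ZS.
pose P z := h z :: t z.
have PD z v : z \in Z -> v \in P z -> v \in D.
  move=> /ht[+ + _ _]; rewrite inE => /andP[hD _]; rewrite path_induced //.
  by move=> /andP[_ /allP tD]; rewrite inE => /orP[/eqP->|/tD].
have P_inj : {in Z &, injective P}.
  move=> z z' zZ z'Z E; apply: (dis z z' (h z)) => //; first exact: mem_head.
  by rewrite -[h z' :: _]/(P z') -E mem_head.
exists [seq P z | z <- enum Z]; split; last 1 first.
- move=> p /mapP[z]; rewrite mem_enum => zZ ->; rewrite inE negb_or eq_sym xu.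
  by apply/negP=> /(PD _ _ zZ); rewrite DP eqxx andbF.
- split.
  + rewrite map_inj_in_uniq ?enum_uniq // => z z'; rewrite !mem_enum.
    exact: P_inj.
  + move=> p /mapP[z]; rewrite mem_enum => zZ ->.
    have [hN hp lE up] := ht z zZ; apply/and3P; split.
    * rewrite /= (path_induced_sub hp) andbT.
      by move: hN; rewrite inE => /andP[].
    * rewrite cons_uniq up andbT.
      by apply/negP=> /(PD _ _ zZ); rewrite DP eqxx.
    by rewrite /= lE -ZE.
  move=> p q /mapP[z]; rewrite mem_enum => zZ -> /mapP[z']; rewrite mem_enum.
  move=> z'Z -> neq v; rewrite inE => /orP[/eqP//|vz].
  rewrite inE => /orP[/eqP//|vz'].
  by case/eqP: neq; rewrite (dis z z' v).
by rewrite size_map -cardE ZE.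
Qed.

(* Among the sets containing x, missing S and having fewer than #|S|
   neighbours, take a largest one A, and let u in S be a non-neighbour of A.
   The fan condition and Menger's theorem yield another such set Au, which has u
   as a neighbour because of the connectivity. By submodularity A :|: Au is
   again such a set, hence Au is part of A and u is a neighbour of A. *)
Lemma linker_not_fan_condition S C k : 0 < k -> #|S| = k -> kappa e = k - 1 ->
  linker S C -> ~ fans_blocked S k.
Proof.
move=> k0 Sk kk /and3P[CS /forall_inP conC /forall_inP lnk] fanS.
have /card_gt0P[s sS] : 0 < #|S| by rewrite Sk.
have /exists_inP[x xC _] := lnk s sS.
have CN c : c \in C -> c \notin S.
  by move=> cC; apply/negP=> cS; have /pred0P/(_ c) := CS; rewrite /= cC cS.
have xS := CN x xC.
have cardS u : u \in S -> #|S :\ u| = k - 1.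
  by move=> uS; rewrite -Sk (cardsD1 u S) uS add1n subn1.
have cut u : u \in S ->
    exists A, [/\ x \in A, [disjoint A & S] & #|nbh A :\ u| < k - 1].
  move=> uS; rewrite -(cardS u uS).
  case: (fan_or_cut xS uS) => // -[Q [fQ sQ uQ]].
  rewrite (cardS u uS) in sQ.
  have [||p pQ] := fanS _ u (subsetDl S [set u]) (cardS u uS) _ x _ xS Q fQ sQ.
  - apply/setP=> z; rewrite !inE negb_and negbK.
    by case: eqVneq => [->|_] /=; rewrite ?uS // andNb.
  - rewrite inE !inE (negPf xS) andbF /=.
    have /exists_inP[c cC uc] := lnk u uS.
    have inD z : z \in C -> z \in ~: (S :\ u).
      by move=> /CN zS; rewrite !inE (negPf zS) andbF.
    apply: (connect_trans (y := c)).
      by apply: connect1; rewrite /induced /= (inD c cC) in_setC in_setD1 eqxx.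
    have /forall_inP/(_ _ xC) := conC c cC.
    by apply: connect_induced_mono; apply/subsetP.
by case/and3P=> uxp; rewrite (negPf (uQ p pQ)) in uxp.
pose P A := [&& x \in A, [disjoint A & S] & #|nbh A| < k].
have free A : #|nbh A| < k -> exists2 u, u \in S & u \notin nbh A.
  move=> Ak; apply/subsetPn; apply: contraL Ak => /subset_leq_card.
  by rewrite Sk -leqNgt.
(* Having fewer than [k] neighbours, [A] misses some [u] of [S], and [nbh A] separates [x] from
   [u]. *)
have tight A : x \in A -> [disjoint A & S] -> k - 1 <= #|nbh A|.
  move=> xA AS; case: (leqP k #|nbh A|) => [|/free[u uS uN]].
    exact: leq_trans (leq_subr _ _).
  rewrite -kk; apply: kappa_le_nbh xA _ uN.
  by apply/negP=> uA; have /pred0P/(_ u) := AS; rewrite /= uA uS.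
have cutP u A : #|nbh A :\ u| < k - 1 -> #|nbh A| < k.
  rewrite (cardsD1 u (nbh A)) -ltnS subn1 prednK // => lt.
  by apply: leq_ltn_trans lt; rewrite -add1n leq_add2r leq_b1.
have [A0 PA0] : exists A, P A.
  have [A [xA AS lA]] := cut s sS; exists A.
  by rewrite /P xA AS (cutP s).
case: (arg_maxnP (fun A : {set T} => #|A|) PA0) => A PA max.
have /and3P[xA AS Ak] := PA.
have [u uS uN] := free A Ak.
have [Au [xAu AuS lAu]] := cut u uS.
have PAu : P Au by rewrite /P xAu AuS (cutP u).
have uAu : u \in nbh Au.
  apply: contraLR (tight _ xAu AuS) => uNu; rewrite -ltnNge.
  by rewrite (cardsD1 u) (negPf uNu).
have /max : P (A :|: Au).
  have AS' : [disjoint A :|: Au & S] by rewrite disjoints_subset subUset -!disjoints_subset AS.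
  have lI : k - 1 <= #|nbh (A :&: Au)|.
    apply: tight; first by rewrite inE xA.
    by apply: disjointWl AS; apply/subsetP=> z; rewrite inE => /andP[].
  have [_ _ Auk] := and3P PAu.
  have ltkE m : (m < k) = (m <= k - 1) by rewrite subn1 -[in RHS]ltnS prednK.
  move: Ak Auk; rewrite /P inE xA AS' /= !ltkE => Ak Auk.
  (* The intersection has at least [k - 1] neighbours, so submodularity leaves at most [k - 1] for
     the union. *)
  rewrite -(leq_add2l (k - 1)); apply: leq_trans (leq_add Ak Auk).
  by apply: leq_trans (nbh_submod A Au); rewrite leq_add2r.
move=> le.
have /eqP AE : A == A :|: Au by rewrite eqEcard subsetUl.
have [uAu' [v vAu vu]] := nbhP _ _ uAu.
case/negP: uN; apply/nbhP; split.
  by apply/negP=> uA; have /pred0P/(_ u) := AS; rewrite /= uA uS.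
by exists v; rewrite // AE inE vAu orbT.
Qed.

(** If some [s] in [S] had no neighbour in the component, the fewer than [k] vertices of [S :\ s]
    would contain all its neighbours and cut [x] off from [s]. *)
Lemma linker_of_kappa S k x : #|S| = k -> k <= kappa e -> x \notin S ->
  linker S (component e (~: S) x).
Proof.
move=> Sk kk xS; have xC : x \in ~: S by rewrite inE.
apply/and3P; split; last 1 first.
- apply/forall_inP=> s sS; apply: contraTT kk; rewrite -ltnNge.
  rewrite negb_exists_in => /forall_inP no.
  apply: leq_ltn_trans (kappa_le_nbh (component_refl xC) (b := s) _ _) _.
  + by rewrite !inE sS.
  + by apply/nbhP=> -[_ [z /no]]; rewrite e_sym => /negPf->.
  rewrite -Sk (cardsD1 s S) sS ltnS subset_leq_card //.
  apply/subsetP=> y yN; rewrite !inE; apply/andP; split.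
    by apply: contraTneq yN => ->; apply/nbhP=> -[_ [z /no]]; rewrite e_sym => /negPf->.
  by move/subsetP: (nbh_component xC) => /(_ _ yN); rewrite setCK.
- by rewrite disjoints_subset component_sub.
exact: component_connected.
Qed.

Lemma no_linker_of_kappa k : k <= #|T| -> kappa e + 2 <= k ->
  exists S, #|S| = k /\ forall C, ~~ linker S C.
Proof.
move=> kT kk; have [U sU kU] := kappa_witness.
have [a [b [aU bU ab]]] : exists a b, [/\ a \notin U, b \notin U
    & ~~ connect (induced e (~: U)) a b].
  case/orP: sU => [|U1].
    case/forall_inPn=> a; rewrite inE => aU /forall_inPn[b].
    by rewrite inE => bU ab; exists a, b.
  (* The degenerate case of [separating] cannot occur: with at least [kappa e + 2] vertices in the
     graph, two lie outside [U]. *)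
  have := leq_trans kk kT; rewrite kU -(cardsC U) addnC.
  by rewrite addnC leq_add2l leqNgt ltnS U1.
have [|S [US Sk]] := @superset_of_card T (a |: (b |: U)) k.
  rewrite kT andbT; apply: leq_trans kk; rewrite kU addn2 !cardsU1.
  by do 2![case: (_ \notin _)]; rewrite ?add1n ?add0n //= ltnW.
have inS v : v \in a |: (b |: U) -> v \in S by apply: (subsetP US).
exists S; split=> // C; apply: contra ab => /and3P[CS /forall_inP conC /forall_inP lnk].
have CU c : c \in C -> c \in ~: U.
  move=> cC; rewrite inE; apply/negP=> cU; have /pred0P/(_ c) := CS.
  by rewrite /= cC inS // !inE cU !orbT.
have /exists_inP[c cC ac] := lnk a (inS _ (setU11 _ _)).
have /exists_inP[d dC bd] := lnk b (inS _ (setU1r _ (setU11 _ _))).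
apply: (connect_trans (y := c)).
  by apply: connect1; rewrite /induced /= inE aU CU.
apply: (connect_trans (y := d)); last first.
  by apply: connect1; rewrite /induced /= CU // in_setC bU e_sym.
have /forall_inP/(_ _ dC) := conC _ cC.
by apply: connect_induced_mono; apply/subsetP.
Qed.

Lemma no_linker_closed_nbh x C : ~~ linker (x |: [set y | e x y]) C.
Proof.
apply/negP=> /and3P[CS _ /forall_inP/(_ _ (setU11 _ _))/exists_inP[c cC xc]].
by have /pred0P/(_ c) := CS; rewrite /= cC !inE xc orbT.
Qed.

Lemma no_linker_fan_condition S k :
  #|S| = k -> (forall C, ~~ linker S C) -> fans_blocked S k.
Proof.
move=> Sk noC S' u1 S'S S'k SS' x xcomp xS Q [Quniq Qpath Qdis] sQ.
have u1SS' : u1 \in S :\: S' by rewrite SS' set11.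
have /andP[u1S' u1S] : (u1 \notin S') && (u1 \in S) by rewrite -in_setD.
have SE s : s \in S -> s = u1 \/ s \in S'.
  move=> sS; case: (boolP (s \in S')) => sS'; [by right|left].
  by apply/set1P; rewrite -SS' inE sS'.
have xu1 : x != u1 by apply: contraNneq xS => ->.
have xSC : x \in ~: S by rewrite inE.
case: (boolP (has (fun p => u1 \in x :: p) Q)) => [/hasP[p pQ u1p]|/hasPn nQ].
  have /and3P[_ _ lS'] := Qpath p pQ.
  exists p; rewrite // /internal_vertex u1p eq_sym xu1.
  by apply: contraNneq u1S' => ->.
case/negP: (noC (component e (~: S) x)); apply/and3P; split.
- by rewrite disjoints_subset component_sub.
- exact: component_connected.
apply/forall_inP=> s /SE[->|sS'].
  move: xcomp; rewrite inE => /andP[_ /connectP[p up xE]].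
  (* After its last visit to [u1] the walk to [x] avoids all of [S], so its next vertex is a
     neighbour of [u1] in the component of [x]. *)
  have [|v [p' [/set1P-> up' lE np' _]]] := last_hit (X := [set u1]) up.
    by rewrite /= inE eqxx.
  rewrite -xE in lE; case: p' up' lE np' => [_ ux|c p' /=]; first by rewrite -ux eqxx in xu1.
  move=> /andP[/and3P[_ cS' uc] cp'] lE /andP[cu1 np'].
  have inD z : z \in ~: S' -> z \notin [set u1] -> z \in ~: S.
    by rewrite !inE => zS' zu; apply/negP=> /SE[/eqP|]; apply/negP.
  have cS := inD c cS' cu1.
  apply/exists_inP; exists c => //; rewrite inE cS.
  rewrite (sym_connect_sym (induced_sym _ e_sym)); apply/connectP; exists p' => //.
  move: cp'; rewrite !path_induced // => /andP[-> /allP p'S'].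
  by apply/allP=> z zp; apply: inD (p'S' z zp) (allP np' z zp).
(* Paths of the fan share only [x], which is not in [S']; hence the [k - 1] ends are distinct and
   exhaust [S']. *)
have last_inj : {in Q &, injective (last x)}.
  move=> p q pQ qQ lE; apply/eqP/negPn/negP => pq.
  have lx := Qdis p q pQ qQ pq _ (mem_last x p).
  rewrite {1}lE mem_last in lx; have /and3P[_ _] := Qpath p pQ.
  by rewrite lx // => /(subsetP S'S); apply/negP.
have onto : [set t in map (last x) Q] = S'.
  apply/eqP; rewrite eqEcard; apply/andP; split.
    by apply/subsetP=> t; rewrite inE => /mapP[p pQ ->]; have /and3P[] := Qpath p pQ.
  rewrite cardsE (card_uniqP _) ?size_map ?sQ ?S'k //.
  by rewrite map_inj_in_uniq.
have ends t : t \in S' -> exists2 p, p \in Q & t = last x p.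
  by rewrite -onto inE => /mapP.
have [p pQ sE] := ends s sS'.
have /and3P[xp up lS'] := Qpath p pQ.
have [|p' [xp' lp' np' sub]] := first_hit (X := S) xp.
  by apply/hasP; exists s; rewrite /= ?(subsetP S'S) // sE mem_last.
(* The first vertex of [S] met is [s] itself: the path avoids [u1], and any other vertex of [S']
   ends a different path of the fan. *)
have {}lp' : last x p' = s.
  have lin := sub _ (mem_last x p').
  case: (SE _ lp') => [lu1|/ends[q qQ lE]].
    by have := nQ p pQ; rewrite -lu1 lin.
  case: (eqVneq p q) => [pq|pq]; first by rewrite lE -pq -sE.
  have lx := Qdis p q pQ qQ pq _ lin.
  by rewrite lE mem_last -lE in lx; rewrite lx // (negPf xS) in lp'.
case/lastP: p' xp' lp' np' {sub} => [_ /= xs|q t]; first by rewrite xs (subsetP S'S) in xS.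
rewrite last_rcons rcons_path belast_rcons => /andP[xq ls] ts /andP[_ nq]; rewrite ts in ls.
have xq' : path (induced e (~: S)) x q.
  rewrite path_induced // xq; apply/allP=> z zq.
  by rewrite /= inE; apply: (allP nq z zq).
have cq : connect (induced e (~: S)) x (last x q) by apply/connectP; exists q.
apply/exists_inP; exists (last x q); last by rewrite e_sym.
by rewrite inE cq (connect_induced_in cq).
Qed.

End Connectivity.

(** * Pedant Steiner trees *)

Lemma set2_inj (T : finType) (x y a b : T) : a != b ->
  ([set x; y] == [set a; b]) = ((x == a) && (y == b)) || ((x == b) && (y == a)).
Proof.
move=> ab; apply/eqP/orP=> [E|[]/andP[/eqP-> /eqP->] //]; last exact: setUC.
have: x \in [set a; b] by rewrite -E set21.
have: y \in [set a; b] by rewrite -E set22.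
have: a \in [set x; y] by rewrite E set21.
have: b \in [set x; y] by rewrite E set22.
rewrite !in_set2 => bxy axy /orP[]/eqP yE /orP[]/eqP xE; rewrite xE yE !eqxx; auto.
  by move: bxy; rewrite xE yE orbb eq_sym (negPf ab).
by move: axy; rewrite xE yE orbb (negPf ab).
Qed.

Section PedantTrees.
Variables (T : finType) (e : rel T).
Hypothesis (e_sym : symmetric e) (e_irr : irreflexive e).
Implicit Types (H : subgraph T) (C S : {set T}).

Lemma mem_edges x y : ([set x; y] \in edges e) = e x y.
Proof.
rewrite inE; apply/existsP/idP=> [[a /existsP[b /andP[ab]]]|xy].
  rewrite set2_inj; last by apply: contraTneq ab => ->; rewrite e_irr.
  by case/orP=> /andP[/eqP-> /eqP->]; rewrite // e_sym.
by exists x; apply/existsP; exists y; rewrite xy eqxx.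
Qed.

Lemma adj_sym H : symmetric (adj H).
Proof. by move=> x y; rewrite /adj /= setUC. Qed.

Lemma adj_subgraph H x y : is_subgraph e H -> adj H x y ->
  [/\ x \in verts H, y \in verts H & e x y].
Proof.
case/andP=> /subsetP He /forall_inP Hv xy.
have /subsetP V := Hv _ xy.
by rewrite -mem_edges; split; [apply: V; rewrite set21|apply: V; rewrite set22|apply: He].
Qed.

(** Sending each leaf in [S] to its only neighbour retracts the tree onto the rest, which is
    therefore connected. For two leaves the tree could be a single edge, with nothing left. *)
Lemma linker_of_pedant_tree S H : 2 < #|S| -> pedant_tree e S H ->
  exists C, linker e S C.
Proof.
move=> S3 /and4P[subH /and3P[_ /forall_inP conH _] /subsetP SH /forall_inP degH].
have adjP x y := @adj_subgraph H x y subH.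
pose pi v := if v \in S then odflt v [pick y | adj H v y] else v.
have piS s : s \in S -> adj H s (pi s) /\ forall y, adj H s y -> y = pi s.
  move=> sS; have /cards1P[v Nv] := degH s sS.
  have N1 y : adj H s y = (y == v) by rewrite -in_set1 -Nv inE.
  rewrite /pi sS; case: pickP => [y sy|/(_ v)]; last by rewrite N1 eqxx.
  split=> // z; move: sy; rewrite /= N1 => /eqP->.
  by rewrite N1 => /eqP.
have pi_out s : s \in S -> pi s \notin S.
  move=> sS; apply/negP=> tS; have [st s1] := piS s sS; have [_ t1] := piS _ tS.
  have ts : s = pi (pi s) by apply: t1; rewrite adj_sym.
  (* Two adjacent leaves would form a set closed under adjacency, hence contain all of [S] by
     connectedness. *)
  have : S \subset [set s; pi s].
    apply/subsetP=> u uS; have /forall_inP/(_ _ (SH u uS)) := conH s (SH s sS).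
    move/(connect_inv (P := mem [set s; pi s])); apply; last by rewrite /= set21.
    move=> a b; rewrite /= => /set2P[]-> /and3P[_ _ ab].
      by rewrite (s1 b ab) set22.
    by rewrite (t1 b ab) -ts set21.
  move/subset_leq_card; rewrite leqNgt cards2; move: S3; case: (_ != _) => /=.
    by move->.
  by move=> S3; rewrite ltnW.
exists (verts H :\: S); apply/and3P; split.
- by rewrite disjoints_subset; apply/subsetP=> z; rewrite !inE => /andP[].
- apply/forall_inP=> x /setDP[xH xS]; apply/forall_inP=> y /setDP[yH yS].
  have /forall_inP/(_ _ yH) := conH x xH.
  have piE z : z \notin S -> pi z = z by rewrite /pi => /negPf->.
  rewrite -{2}(piE x xS) -{2}(piE y yS); apply: connect_morph => a b.
  move=> /and3P[aH bH ab]; have [_ _ eab] := adjP _ _ ab.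
  case: (boolP (a \in S)) => aS.
    have [_ /(_ b ab) bE] := piS a aS.
    by rewrite (piE b) ?bE ?connect0 // pi_out.
  rewrite (piE a aS); case: (boolP (b \in S)) => bS.
    have [_ /(_ a)<-] := piS b bS; first exact: connect0.
    by rewrite adj_sym.
  by rewrite (piE b bS) connect1 // /induced /= !inE aS bS aH bH.
apply/forall_inP=> s sS; have [/adjP[_ pH spi] _] := piS s sS.
by apply/exists_inP; exists (pi s); rewrite // inE pH pi_out.
Qed.

(** * Growing trees leaf by leaf *)

Definition add_leaf H v w : subgraph T := (v |: verts H, [set v; w] |: sedges H).

Lemma adj_add_leaf H v w x y : v != w ->
  adj (add_leaf H v w) x y =
  [|| (x == v) && (y == w), (x == w) && (y == v) | adj H x y].
Proof. by move=> vw; rewrite /adj /= in_setU1 set2_inj // orbA. Qed.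

Lemma add_leaf_tree H v w : is_subgraph e H -> is_tree H ->
  w \in verts H -> v \notin verts H -> e v w ->
  is_subgraph e (add_leaf H v w) /\ is_tree (add_leaf H v w).
Proof.
move=> subH /and3P[_ /forall_inP conH /forallP acH] wH vH vw.
have v_w : v != w by apply: contraNneq vH => ->.
have adjE := adj_add_leaf H _ _ v_w.
have nv y : adj H v y = false.
  by apply/negP=> /(adj_subgraph subH)[vH']; rewrite vH' in vH.
have adjv y : adj (add_leaf H v w) v y = (y == w).
  by rewrite adjE eqxx nv (negPf v_w) /= orbF.
split.
  case/andP: subH => He /forall_inP Hv; apply/andP; split.
    by rewrite subUset sub1set mem_edges vw.
  apply/forall_inP=> a; rewrite in_setU1 => /orP[/eqP->|/Hv aH].
    by rewrite subUset !sub1set !inE eqxx wH orbT.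
  exact: subset_trans aH (subsetUr _ _).
apply/and3P; split.
- by apply/set0Pn; exists v; exact: setU11.
- have fromw x : x \in verts (add_leaf H v w) ->
    connect (induced (adj (add_leaf H v w)) (verts (add_leaf H v w))) w x.
    rewrite in_setU1 => /orP[/eqP->|xH].
      by apply: connect1; rewrite /induced /= !inE wH eqxx orbT /= adjE !eqxx orbT.
    have /forall_inP/(_ _ xH) := conH w wH; apply: connect_sub => a b.
    move=> /and3P[aH bH ab]; apply: connect1.
    by rewrite /induced /= !inE aH bH !orbT /= adjE ab !orbT.
  apply/forall_inP=> x xV; apply/forall_inP=> y yV.
  apply: connect_trans (fromw y yV).
  by rewrite (sym_connect_sym (induced_sym _ (adj_sym _))) fromw.
apply/forallP=> m; apply/forallP=> c; apply/implyP=> m2; apply/negP=> /andP[cyc uc].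
case: (boolP (v \in val c)) => vc; last first.
  have /forallP/(_ c)/implyP/(_ m2)/negP[] := acH m; rewrite /ucycleb uc andbT.
  apply: sub_in_cycle (cyc); last by apply/allP=> z zc; exact: zc.
  move=> x y xc yc; rewrite adjE.
  by case/or3P=> // /andP[/eqP xE /eqP yE]; rewrite -?xE -?yE ?xc ?yc in vc.
(* Rotated to start at [v], a cycle has two different vertices next to [v], yet both must be [w]. *)
have [i c' cE] := rot_to vc.
have : cycle (adj (add_leaf H v w)) (v :: c') by rewrite -cE rot_cycle.
have : uniq (v :: c') by rewrite -cE rot_uniq.
have : 1 < size c' by rewrite -ltnS -[(size c').+1]/(size (v :: c')) -cE size_rot size_tuple.
move: (adj (add_leaf H v w)) adjv (@adj_sym (add_leaf H v w)) => r rv rsym.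
case: c' {cE} => [|a [|b c']] // _ /= /and3P[_ ac' _].
rewrite rv rcons_path (rsym (last _ _)) rv => /and4P[/eqP aw _ _ /eqP lw].
by rewrite aw -lw mem_last in ac'.
Qed.

(** Starting from [[set x]], a tree that does not yet cover [C] has an edge leaving it inside [C],
    whose outer end becomes a leaf. *)
Lemma spanning_tree C x : x \in C -> connected_in e C ->
  exists H, [/\ is_subgraph e H, is_tree H & verts H = C].
Proof.
move=> xC /forall_inP conC.
have C0 : 0 < #|C| by apply/card_gt0P; exists x.
suff [H [sH tH VC Vm]] : exists H, [/\ is_subgraph e H, is_tree H,
    verts H \subset C & #|verts H| = #|C|.-1.+1].
  by exists H; split=> //; apply/eqP; rewrite eqEcard VC Vm prednK ?leqnn.
have : #|C|.-1 < #|C| by rewrite prednK.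
elim: (#|C|.-1) => [|m IH] mC.
  exists ([set x], set0); split; rewrite /= ?cards1 ?sub1set //.
    by rewrite /is_subgraph /= sub0set; apply/forall_inP=> a; rewrite inE.
  apply/and3P; split.
  - by apply/set0Pn; exists x; rewrite inE.
  - by apply/forall_inP=> a /set1P-> ; apply/forall_inP=> b /set1P->; rewrite connect0.
  apply/forallP=> n; apply/forallP=> -[[|a [|b c]] /= /eqP <-] //=.
  by rewrite {1}/ucycleb /adj /sedges /= in_set0 /= implybT.
have [H [sH tH VC Vm]] := IH (ltnW mC).
have /subsetPn[z zC zH] : ~~ (C \subset verts H).
  by apply/negP=> /subset_leq_card; rewrite Vm leqNgt mC.
have /and3P[/set0Pn[a aH] _ _] := tH.
have /exists_inP[w wH /exists_inP[v /setDP[vC vH] vw]] :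
    [exists w in verts H, exists v in C :\: verts H, e v w].
  apply: contraNT zH; rewrite negb_exists_in => /forall_inP no.
  have /forall_inP/(_ _ zC) := conC a (subsetP VC a aH).
  move/(connect_inv (P := mem (verts H))); apply=> // w v wH /and3P[_ vC wv].
  apply: contraT => vH; have := no w wH; rewrite negb_exists_in => /forall_inP.
  by move=> /(_ v); rewrite inE vH vC e_sym wv => /(_ isT).
have [sH' tH'] := add_leaf_tree sH tH wH vH vw.
exists (add_leaf H v w); split=> //=.
  by rewrite subUset sub1set vC.
by rewrite cardsU1 vH Vm.
Qed.

(** The vertices of [S] are hung one by one on a spanning tree of [C]. Every new edge goes to [C],
    so earlier leaves keep degree one. *)
Lemma pedant_tree_of_linker S C : 0 < #|S| -> linker e S C ->
  exists H, pedant_tree e S H.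
Proof.
move=> /card_gt0P[s0 s0S] /and3P[CS conC /forall_inP lnk].
have /exists_inP[x xC _] := lnk s0 s0S.
have CN c : c \in C -> c \notin S.
  by move=> cC; apply/negP=> cS; have /pred0P/(_ c) := CS; rewrite /= cC cS.
suff [H [sH tH VH dH]] : exists H, [/\ is_subgraph e H, is_tree H,
    verts H = C :|: [set t in enum S] & forall t, t \in enum S -> deg (adj H) t = 1].
  exists H; apply/and4P; split=> //.
    by rewrite VH; apply/subsetP=> s sS; rewrite !inE mem_enum sS orbT.
  by apply/forall_inP=> s sS; rewrite dH // mem_enum.
have : {subset enum S <= S} by move=> s; rewrite mem_enum.
elim: (enum S) (enum_uniq S) => [_ _|v s IH /andP[vs us] sS].
  have [H [sH tH VH]] := spanning_tree xC conC; exists H; split=> //.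
  by rewrite VH; apply/setP=> z; rewrite !inE orbF.
have [|H [sH tH VH dH]] := IH us.
  by move=> t ts; apply: sS; rewrite inE ts orbT.
have vS : v \in S by apply: sS; rewrite mem_head.
have /exists_inP[c cC vc] := lnk v vS.
have vH : v \notin verts H.
  by rewrite VH !inE negb_or vs andbT; apply: contraL vS; apply: CN.
have cH : c \in verts H by rewrite VH inE cC.
have [sH' tH'] := add_leaf_tree sH tH cH vH vc.
have v_c : v != c by apply: contraNneq vH => ->.
exists (add_leaf H v c); split=> //=.
  by rewrite VH; apply/setP=> z; rewrite !inE orbCA.
move=> t; rewrite inE => /predU1P[->|ts].
  rewrite -(cards1 c); apply: eq_card => y; rewrite !inE adj_add_leaf // eqxx.
  rewrite (negPf v_c) /=; case: eqP => //= _.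
  by apply/negP=> /(adj_subgraph sH)[vH']; rewrite vH' in vH.
have t_v : t != v by apply: contraNneq vs => <-.
have t_c : t != c.
  by apply: contraTneq cC => <-; apply/negP=> /CN; rewrite sS // inE ts orbT.
rewrite -(dH t ts); apply: eq_card => y; rewrite !inE adj_add_leaf //.
by rewrite (negPf t_v) (negPf t_c).
Qed.

Lemma tau_gt0P S : 2 < #|S| -> reflect (exists C, linker e S C) (0 < tau e S).
Proof.
move=> S3; have S0 : 0 < #|S| by exact: leq_trans S3.
apply: (iffP idP) => [|[C /(pedant_tree_of_linker S0)[H HS]]].
  move=> tau0; apply/existsP; apply: contraLR tau0 => no.
  rewrite -leqNgt; apply/bigmax_leqP=> F /andP[/forall_inP FP _].
  rewrite leqNgt; apply: contra no => /card_gt0P[H /FP HS].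
  exact/existsP/(linker_of_pedant_tree S3 HS).
have HF : pedant_family e S [set H].
  apply/andP; split; apply/forall_inP=> H1 /set1P->; first exact: HS.
  by apply/forall_inP=> H2 /set1P->; rewrite eqxx.
by rewrite -(cards1 H); apply: (leq_bigmax_cond [set H] HF).
Qed.

Lemma tau_k_eq0 k : 2 < k <= #|T| ->
  tau_k e k = 0 <-> exists S, #|S| = k /\ forall C, ~~ linker e S C.
Proof.
case/andP=> k3 kT.
have tau0 S : #|S| = k -> tau e S = 0 <-> forall C, ~~ linker e S C.
  move=> Sk; have S3 : 2 < #|S| by rewrite Sk.
  split=> [t0 C|no].
    apply/negP=> SC; have : 0 < tau e S by apply/(tau_gt0P S3); exists C.
    by rewrite t0.
  apply/eqP; rewrite -leqn0 leqNgt; apply/(tau_gt0P S3) => -[C].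
  by apply/negP.
(* A [k]-set exists, so [minval] is a true minimum and not the default 0. *)
have [|S0 [_ S0k]] := @superset_of_card T set0 k; first by rewrite cards0 kT.
have [|S1 [/eqP S1k tE min]] := @minvalP _ (fun S : {set T} => #|S| == k) (tau e) S0.
  exact/eqP.
rewrite /tau_k; split=> [t0|[S [Sk /(tau0 S Sk) t0]]].
  by exists S1; split=> //; apply/(tau0 S1 S1k); rewrite -tE.
by apply/eqP; rewrite -leqn0 -t0; apply: min; apply/eqP.
Qed.

End PedantTrees.

(** * Vanishing of [tau_k] in terms of connectivity and degree *)

Theorem theorem7 (T : finType) (e : rel T)
    (e_sym : symmetric e) (e_irr : irreflexive e)
    (k n : nat) (k_ge3 : 3 <= k) (k_le_n : k <= n)
    (order_G : #|T| = n) (e_conn : connected_in e [set: T]) :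
  tau_k e k = 0 <->
  [\/ 0 <= kappa e <= k - 2,
      kappa e = min_degree e /\ min_degree e = k - 1
    | [/\ kappa e = k - 1, k <= min_degree e & fan_condition e k]].
Proof.
have kT : k <= #|T| by rewrite order_G.
have k0 : 0 < k by exact: leq_trans k_ge3.
have /card_gt0P[x0 _] : 0 < #|T| by exact: leq_trans kT.
have [x [_ degE _]] := @minvalP _ predT (deg e) x0 isT.
have kd : kappa e <= min_degree e by rewrite /min_degree degE kappa_le_deg.
have k3T : 2 < k <= #|T| by rewrite k_ge3.
apply: (iff_trans (tau_k_eq0 e_sym e_irr k3T)); split=> [[S [Sk noC]]|].
  have kk : kappa e < k.
    (* Since [k <= kappa e < #|T|], some vertex lies outside [S], and its component is a linker. *)
    rewrite ltnNge; apply/negP=> kk.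
    have /subsetPn[y _ yS] : ~~ ([set: T] \subset S).
      apply/negP=> /subset_leq_card; rewrite cardsT Sk leqNgt.
      by rewrite (leq_ltn_trans kk) // kappa_lt_card // (leq_trans k0).
    have /negP[] := noC (component e (~: S) y).
    exact: linker_of_kappa Sk kk yS.
  case: (leqP (k - 1) (kappa e)) => kk1; last first.
    by constructor 1; rewrite /= -ltnS -subSn ?subSS // ltnW.
  have kE : kappa e = k - 1 by apply/eqP; rewrite eqn_leq kk1 andbT -ltnS subn1 prednK.
  case: (leqP k (min_degree e)) => dk.
    constructor 3; split=> //; exists S; split=> //.
    exact: no_linker_fan_condition.
  have dE : min_degree e = k - 1.
    apply/eqP; rewrite eqn_leq -{2}kE kd andbT.
    by rewrite -ltnS subn1 prednK.
  by constructor 2; rewrite kE dE.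
case=> [kk|[kE dE]|[kE _ [S [Sk fanS]]]].
- apply: no_linker_of_kappa => //.
  by rewrite addnC -leq_subRL // ltnW.
(* Here [x] attains the minimum degree [k - 1], so its closed neighbourhood has [k] vertices. *)
- exists (x |: [set y | e x y]); split; last exact: no_linker_closed_nbh.
  rewrite cardsU1 inE e_irr /=; move: dE; rewrite /min_degree degE /deg => ->.
  by rewrite subnKC.
exists S; split=> // C; apply/negP=> SC.
exact: linker_not_fan_condition k0 Sk kE SC fanS.
Qed.
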